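(* If $H_1,\ldots,H_k$ are $k \geq 2$ graphs each with at most $n$ vertices, chromatic number at most $q$, and maximum degree at most $\Delta$, then $r(H_1,\ldots,H_k) \leq k^{2k\Delta q}n$.
   Context: The $k$-color Ramsey number $r(H_1,\ldots,H_k)$ is the least positive integer $N$ such that for every coloring of the edges of the complete graph $K_N$ with colors $1,\ldots,k$, there is some $i\in\{1,\ldots,k\}$ and a copy of $H_i$ (a subgraph isomorphic to $H_i$) all of whose edges have color $i$. *)

(* Defs.v *)
From mathcomp Require Import all_boot.

Set Implicit Arguments.
Unset Strict Implicit.
Unset Printing Implicit Defensive.

Record sgraph := SGraph {
  vertex :> finType;
  adj : rel vertex;
  adj_sym : symmetric adj;
  adj_irrefl : irreflexive adj
}.

Definition degree (G : sgraph) (x : G) : nat := #|[set y | adj x y]|.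

Definition max_degree (G : sgraph) : nat := \max_(x : G) degree x.

Definition colorable (G : sgraph) (q : nat) : bool :=
  [exists f : {ffun G -> 'I_q}, forall x, forall y, adj x y ==> (f x != f y)].

Lemma colorable_ex (G : sgraph) : exists q, colorable G q.
Proof.
exists #|G|; apply/existsP; exists [ffun x => enum_rank x].
apply/forallP => x; apply/forallP => y; apply/implyP => xy; rewrite !ffunE.
apply/eqP => /enum_rank_inj exy.
by move: xy; rewrite exy adj_irrefl.
Qed.

Definition chromatic_number (G : sgraph) : nat := ex_minn (colorable_ex G).

(* An edge coloring of the complete graph on 'I_N: the edge xy has color
   c [set x; y]; the values of c on sets which are not pairs are irrelevant. *)
Definition edge_coloring (N k : nat) : Type := {set 'I_N} -> 'I_k.

Definition mono_copy (N k : nat) (c : edge_coloring N k) (i : 'I_k)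
    (G : sgraph) : Prop :=
  exists2 f : G -> 'I_N,
    injective f & forall x y, adj x y -> c [set f x; f y] = i.

Definition ramsey_prop (k : nat) (H : 'I_k -> sgraph) (N : nat) : Prop :=
  forall c : edge_coloring N k, exists i : 'I_k, mono_copy c i (H i).

(* r = r(H_1, ..., H_k), as a relation, since r(H_1, ..., H_k) is well defined
   only by Ramsey's theorem. *)
Definition is_ramsey_number (k : nat) (H : 'I_k -> sgraph) (r : nat) : Prop :=
  [/\ 0 < r, ramsey_prop H r
    & forall N, 0 < N -> ramsey_prop H N -> r <= N].

(* Main.v *)
(* Dependent random choice, applied repeatedly: inside a set [A], the common
   neighborhood [B], in a suitable color, of [2 * Delta] random vertices has
   about [#|A| / k ^ (2 * Delta)] vertices, and only few [Delta]-tuples of [B]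
   have fewer than [2 * n] common neighbors in [A] in that color. Iterating
   [k * (q - 2) + 1] times from all vertices gives a decreasing sequence of
   sets, and by the pigeonhole principle some color [i] is used at least
   [q - 1] times. This yields [q] nested sets, one for each class of a proper
   [q]-coloring of [H i]; the vertices of [H i] are embedded greedily, starting
   with the class assigned to the smallest set, in such a way that the
   images of the neighbors of a vertex always have enough common neighbors. *)
Require Import Defs.
From mathcomp Require Import all_boot.
From mathcomp Require Import zify ring.
From Stdlib Require Import Classical.

Set Implicit Arguments.
Unset Strict Implicit.
Unset Printing Implicit Defensive.

(** * Power means of natural numbers *)

Lemma leq_rearrange_exp (x y t : nat) :
  x * y ^ t + y * x ^ t <= x ^ t.+1 + y ^ t.+1.
Proof.
wlog xy : x y / x <= y.
  move=> H; case/orP: (leq_total x y) => [/H //|/H].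
  by rewrite addnC [X in _ <= X]addnC.
rewrite !expnS.
have hp : x ^ t <= y ^ t by case: (t) => [|u] //; rewrite leq_exp2r.
by move: (x ^ t) (y ^ t) hp => p r hp; nia.
Qed.

(** Both sides, doubled, become sums over pairs [(i, j)] that compare termwise by rearrangement. *)
Lemma leq_chebyshev_exp (I : finType) (x : I -> nat) (t : nat) :
  (\sum_i x i) * (\sum_i x i ^ t) <= #|I| * \sum_i x i ^ t.+1.
Proof.
have E1 : (\sum_i x i) * (\sum_i x i ^ t) = \sum_i \sum_j x i * x j ^ t.
  by rewrite big_distrl; apply: eq_bigr => i _; rewrite big_distrr.
have E2 : (\sum_i x i) * (\sum_i x i ^ t) = \sum_i \sum_j x j * x i ^ t.
  by rewrite E1 exchange_big.
have E3 : #|I| * \sum_i x i ^ t.+1 = \sum_i \sum_(j : I) x i ^ t.+1.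
  rewrite big_distrr; apply: eq_bigr => i _; by rewrite sum_nat_const.
have E4 : #|I| * \sum_i x i ^ t.+1 = \sum_(i : I) \sum_j x j ^ t.+1.
  by rewrite E3 exchange_big.
rewrite -(@leq_pmul2l 2) // !mul2n -!addnn {1}E1 E2 {1}E3 E4 -!big_split /=.
apply: leq_sum => i _; rewrite -!big_split; apply: leq_sum => j _.
exact: leq_rearrange_exp.
Qed.

Lemma leq_power_mean (I : finType) (x : I -> nat) (t : nat) :
  (\sum_i x i) ^ t.+1 <= #|I| ^ t * \sum_i x i ^ t.+1.
Proof.
elim: t => [|t IH]; first by rewrite mul1n expn1; under [X in _ <= X]eq_bigr do rewrite expn1.
rewrite expnS; apply: leq_trans (leq_mul (leqnn _) IH) _.
rewrite mulnCA expnSr -mulnA leq_mul2l; apply/orP; right.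
exact: leq_chebyshev_exp.
Qed.

(** * Sums over sequences of vertices *)

Section SumSeq.
Variable V : finType.
Implicit Types (A B : {set V}) (F G : seq V -> nat).

(** Up to the factor [#|A| ^ t], the expectation of [F] over [t] independent uniform elements of
    [A]. *)
Fixpoint sum_seq A t F : nat :=
  if t is t'.+1 then \sum_(y in A) sum_seq A t' (fun s => F (y :: s))
  else F [::].

Lemma eq_sum_seq A t F G : F =1 G -> sum_seq A t F = sum_seq A t G.
Proof.
elim: t F G => [|t IH] F G FG /=; first exact: FG.
by apply: eq_bigr => y _; apply: IH => s; apply: FG.
Qed.

Lemma leq_sum_seq A t F G :
  (forall s, F s <= G s) -> sum_seq A t F <= sum_seq A t G.
Proof.
elim: t F G => [|t IH] F G FG //=.
by apply: leq_sum => y _; apply: IH => s; apply: FG.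
Qed.

Lemma sum_seqD A t F G :
  sum_seq A t (fun s => F s + G s) = sum_seq A t F + sum_seq A t G.
Proof.
elim: t F G => [|t IH] F G //=.
by rewrite -big_split; apply: eq_bigr => y _; rewrite IH.
Qed.

Lemma sum_seqM A t a F :
  sum_seq A t (fun s => a * F s) = a * sum_seq A t F.
Proof.
elim: t F => [|t IH] F //=.
by rewrite big_distrr; apply: eq_bigr => y _; rewrite IH.
Qed.

Lemma sum_seq_const A t a : sum_seq A t (fun=> a) = #|A| ^ t * a.
Proof.
elim: t => [|t IH] /=; first by rewrite mul1n.
by rewrite IH sum_nat_const expnS mulnA.
Qed.

Lemma sum_seq_sum (I : Type) (r : seq I) (P : pred I) A t
    (F : I -> seq V -> nat) :
  sum_seq A t (fun s => \sum_(i <- r | P i) F i s)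
  = \sum_(i <- r | P i) sum_seq A t (F i).
Proof.
elim: t F => [|t IH] F //=.
by rewrite exchange_big; apply: eq_bigr => y _; rewrite IH.
Qed.

Lemma exchange_sum_seq A B t d (F : seq V -> seq V -> nat) :
  sum_seq A t (fun s => sum_seq B d (F s))
  = sum_seq B d (fun u => sum_seq A t (F^~ u)).
Proof.
elim: t F => [|t IH] F //=.
by rewrite sum_seq_sum; apply: eq_bigr => y _; rewrite IH.
Qed.

Lemma sum_seq_all A t (P : pred V) :
  sum_seq A t (fun s => all P s) = #|[set y in A | P y]| ^ t.
Proof.
elim: t => [|t IH] //=.
rewrite expnS -IH -sum1_card big_distrl /=.
rewrite [RHS](eq_bigl (fun y => (y \in A) && P y)); last by move=> y; rewrite !inE.
rewrite big_mkcondr; apply: eq_bigr => y _; case: (P y) => /=.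
  by rewrite mul1n.
by rewrite sum_seq_const muln0.
Qed.

Lemma sum_seq_filter A t (P : pred V) F :
  sum_seq [set y in A | P y] t F = sum_seq A t (fun s => all P s * F s).
Proof.
elim: t F => [|t IH] F /=; first by rewrite mul1n.
rewrite [LHS](eq_bigl (fun y => (y \in A) && P y)); last by move=> y; rewrite !inE.
rewrite big_mkcondr; apply: eq_bigr => y _; case: (P y) => /=.
  by rewrite IH; apply: eq_sum_seq => s.
by rewrite sum_seq_const muln0.
Qed.

(** The first moment method: if [F] exceeded [G] everywhere, its sum would be strictly larger, as
    [A] is nonempty. *)
Lemma sum_seq_leq_exists A t F G :
  0 < #|A| -> sum_seq A t F <= sum_seq A t G -> exists s, F s <= G s.
Proof.
move=> A0; elim: t F G => [|t IH] F G /=; first by exists [::].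
case: (boolP [exists y in A, sum_seq A t (fun s => F (y :: s))
                             <= sum_seq A t (fun s => G (y :: s))]).
  by case/exists_inP => y _ /IH [s Fs] _; exists (y :: s).
rewrite negb_exists_in => /forall_inP H.
rewrite leqNgt => /negP [].
have: \sum_(y in A) sum_seq A t (fun s => G (y :: s)) + #|A|
      <= \sum_(y in A) sum_seq A t (fun s => F (y :: s)).
  rewrite -sum1_card -big_split; apply: leq_sum => y /H.
  by rewrite -ltnNge /= addn1.
by apply: leq_trans; rewrite -[X in X < _]addn0 ltn_add2l.
Qed.

End SumSeq.

(** * Common neighborhoods and dangerous tuples *)

Section CommonNeighbors.
Variable V : finType.
Implicit Types (A B : {set V}) (s : seq V) (R : rel V).

Definition common R A s : {set V} := [set y in A | all (R y) s].

Lemma common_cons R A y s : common R A (y :: s) \subset common R A s.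
Proof. by apply/subsetP => z; rewrite !inE /= => /and3P [-> _ ->]. Qed.

(* If [s] is dangerous, then at least [(m / D) ^ h] of its extensions by [h]
   vertices of [B] have fewer than [m] common neighbors in [A]. Defining it one
   vertex at a time makes it hereditary: if [s] is not dangerous, then all but at most
   [m / D] vertices [y] keep [y :: s] from being dangerous. *)
Fixpoint danger R m D A B h s : bool :=
  if h is h'.+1 then m < D * #|[set y in B | danger R m D A B h' (y :: s)]|
  else #|common R A s| < m.

Lemma dangerS R m D A B B' h s :
  B \subset B' -> danger R m D A B h s -> danger R m D A B' h s.
Proof.
move=> BB'; elim: h s => [|h IH] s //= /leq_trans; apply.
rewrite leq_mul2l; apply/orP; right; apply: subset_leq_card.
by apply/subsetP => y; rewrite !inE => /andP [/(subsetP BB') -> /IH].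
Qed.

(** Extending [s] only shrinks its common neighborhood, so every vertex of [B] is a bad extension at
    every level. The contrapositive gives non-dangerous tuples many common neighbors. *)
Lemma danger_common R m D A B h s :
  m < D * #|B| -> #|common R A s| < m -> danger R m D A B h s.
Proof.
move=> mB; elim: h s => [|h IH] s //= ms.
rewrite (_ : [set _ in _ | _] = B) //; apply/setP => y; rewrite !inE.
rewrite IH ?andbT //; apply: leq_ltn_trans ms.
exact/subset_leq_card/common_cons.
Qed.

(** Each level of the recursion contributes a factor above [m / D]; the summand [0 < h] records this
    strictness. *)
Lemma danger_sum_seq R m D A B h s :
  0 < m -> danger R m D A B h s ->
  m ^ h + (0 < h)
  <= D ^ h * sum_seq B h (fun u => #|common R A (catrev u s)| < m).
Proof.
move=> m0; elim: h s => [|h IH] s /=; first by rewrite mul1n => ->.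
set E := [set _ in _ | _] => mE; rewrite addn1.
set S := \sum_(y in B) _.
have ES : #|E| * m ^ h <= D ^ h * S.
  rewrite -sum1_card big_distrl big_distrr /=.
  rewrite (eq_bigl (fun y => (y \in B) && danger R m D A B h (y :: s))); last first.
    by move=> y; rewrite !inE.
  rewrite big_mkcondr; apply: leq_sum => y _; case: ifP => // /IH.
  by rewrite mul1n; apply: leq_trans; apply: leq_addr.
rewrite !expnS -mulnA; apply: (@leq_trans (D * #|E| * m ^ h)).
  by rewrite ltn_pmul2r // expn_gt0 m0.
by rewrite -mulnA leq_mul2l ES orbT.
Qed.

End CommonNeighbors.

(** * Dependent random choice and chains of nested sets *)

Section DependentRandomChoice.
Variables (V : finType) (k : nat) (col : V -> V -> 'I_k).
Hypothesis col_sym : forall x y, col x y = col y x.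

Definition colrel (c : 'I_k) : rel V := fun x y => col x y == c.

Lemma colrel_sym c : symmetric (colrel c).
Proof. by move=> x y; rewrite /colrel col_sym. Qed.

Lemma all_common c (s u : seq V) :
  all (fun y => all (colrel c y) u) s = all (fun x => all (colrel c x) s) u.
Proof.
apply/allP/allP => H x xs; apply/allP => y ys.
  by rewrite colrel_sym; apply: (allP (H y ys)).
by rewrite colrel_sym; apply: (allP (H y ys)).
Qed.

Lemma sum_colrel (A : {set V}) v : \sum_c #|[set y in A | colrel c v y]| = #|A|.
Proof.
rewrite -sum1_card (partition_big (col v) xpredT) //=.
apply: eq_bigr => c _; rewrite -sum1_card; apply: eq_bigl => y.
by rewrite !inE.
Qed.

(* [t.+1] random vertices of [A] have on average, over the vertices and the
   colors, a common neighborhood of size at least [#|A| / k ^ t.+1]. *)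
Lemma sum_common_ge (A : {set V}) t :
  #|A| ^ t.+2 <=
  k ^ t * \sum_c sum_seq A t.+1 (fun T => #|common (colrel c) A T|).
Proof.
(* Double counting of the pairs of a sequence [T] and a common neighbor [v]; the power mean
   inequality over the colors then applies to each [v]. *)
have -> : \sum_c sum_seq A t.+1 (fun T => #|common (colrel c) A T|)
          = \sum_(v in A) \sum_c #|[set y in A | colrel c v y]| ^ t.+1.
  rewrite [RHS]exchange_big; apply: eq_bigr => c _.
  under [RHS]eq_bigr do rewrite -sum_seq_all.
  rewrite -sum_seq_sum; apply: eq_sum_seq => T.
  rewrite /common -sum1_card.
  rewrite (eq_bigl (fun y => (y \in A) && all (colrel c y) T)); last first.
    by move=> y; rewrite !inE.
  by rewrite big_mkcondr; apply: eq_bigr => y _; case: all.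
rewrite expnS -sum_nat_const big_distrr /=; apply: leq_sum => v _.
by have := leq_power_mean (fun c => #|[set y in A | colrel c v y]|) t;
   rewrite sum_colrel card_ord.
Qed.

(** By symmetry, [s] lies in the common neighborhood of [T] exactly when [T] lies in that of [s]. A
    bad [s] thus survives for at most [m ^ t] choices of [T]. *)
Lemma sum_bad_le (A : {set V}) c m d t :
  sum_seq A t (fun T => sum_seq (common (colrel c) A T) d
                 (fun s => #|common (colrel c) A (rev s)| < m))
  <= #|A| ^ d * m ^ t.
Proof.
under eq_sum_seq do rewrite sum_seq_filter.
rewrite exchange_sum_seq -sum_seq_const; apply: leq_sum_seq => s.
have -> : sum_seq A t (fun T => all (fun y => all (colrel c y) T) s
                           * (#|common (colrel c) A (rev s)| < m))
   = (#|common (colrel c) A (rev s)| < m) * #|common (colrel c) A s| ^ t.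
  rewrite -sum_seq_all -sum_seqM; apply: eq_sum_seq => T.
  by rewrite mulnC all_common.
have -> : common (colrel c) A (rev s) = common (colrel c) A s.
  by apply/setP => y; rewrite !inE all_rev.
case: ltnP => [sm|_]; last by rewrite mul0n.
by rewrite mul1n; case: (t) => [|u] //; rewrite leq_exp2r // ltnW.
Qed.

Lemma dependent_random_choice (A : {set V}) (d m a : nat) :
  0 < k -> 0 < d -> 0 < m -> 0 < a -> a * m <= #|A| ->
  exists c, exists2 B : {set V}, B \subset A
    & #|A| <= k ^ (2 * d) * #|B| + a * m
    /\ a ^ d * sum_seq B d (fun s => #|common (colrel c) A (rev s)| < m)
       <= k ^ (2 * d) * m ^ d.
Proof.
move=> k0; case: d => // d _ m0 a0; rewrite mulnS /=.
set M := #|A| => aM.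
have M0 : 0 < M by apply: leq_trans aM; rewrite muln_gt0 a0.
pose X c T := #|common (colrel c) A T|.
pose bad c T := sum_seq (common (colrel c) A T) d.+1
                 (fun s => #|common (colrel c) A (rev s)| < m).
set t := (2 * d).+1.
(* One averaged inequality must control both the size and the bad tuples. With these weights the
   average of the [bad] term is offset exactly by the subtracted [a * m]. *)
pose F T := \sum_c (a * M ^ d.+1 * bad c T + m ^ t * (M - a * m)).
pose G T := \sum_c (m ^ t * k ^ t.+1 * X c T).
have /(sum_seq_leq_exists M0) [T] : sum_seq A t.+1 F <= sum_seq A t.+1 G.
  rewrite /F /G !sum_seq_sum.
  have -> : \sum_c sum_seq A t.+1 (fun T => m ^ t * k ^ t.+1 * X c T)
     = m ^ t * k * (k ^ t * \sum_c sum_seq A t.+1 (X c)).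
    by rewrite mulnA expnS mulnA big_distrr; apply: eq_bigr => c _;
       rewrite sum_seqM.
  apply: leq_trans (leq_mul (leqnn _) (sum_common_ge A t)).
  apply: (@leq_trans (\sum_(c < k) (a * M ^ d.+1 * (M ^ d.+1 * m ^ t.+1)
                        + M ^ t.+1 * (m ^ t * (M - a * m))))).
    apply: leq_sum => c _; rewrite sum_seqD sum_seqM sum_seq_const leq_add2r.
    by rewrite leq_mul2l sum_bad_le orbT.
  rewrite sum_nat_const card_ord [m ^ t * k]mulnC -[k * _ * _]mulnA leq_mul2l.
  apply/orP; right; rewrite -/M.
  have EM : M ^ t = M * (M ^ d * M ^ d) by rewrite /t expnS mul2n -addnn expnD.
  rewrite [M ^ t.+2]expnS [M ^ t.+1]expnS EM [M ^ d.+1]expnS [m ^ t.+1]expnS.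
  move: (M ^ d) (m ^ t) => p u; rewrite -(subnK aM).
  move: (M - a * m) => r; rewrite addnK; apply/eq_leq; ring.
rewrite /F /G => FG.
have [c cFG] : exists c, a * M ^ d.+1 * bad c T + m ^ t * (M - a * m)
                   <= m ^ t * k ^ t.+1 * X c T.
  case: (boolP [exists c, a * M ^ d.+1 * bad c T + m ^ t * (M - a * m)
                   <= m ^ t * k ^ t.+1 * X c T]) => [/existsP //|].
  rewrite negb_exists => /forallP H; move: FG; rewrite leqNgt => /negP [].
  pose c0 := Ordinal k0.
  rewrite (bigD1 c0) // [X in _ < X](bigD1 c0) //= -addSn.
  apply: leq_add; first by rewrite ltnNge H.
  by apply: leq_sum => c _; apply: ltnW; rewrite ltnNge H.
have XM : X c T <= M by apply: subset_leq_card; apply/subsetP => y; rewrite inE => /andP [].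
exists c, (common (colrel c) A T); first by apply/subsetP => y; rewrite inE => /andP [].
rewrite -/(bad c T) -/(X c T); split.
  rewrite addnC -leq_subLR.
  have : m ^ t * (M - a * m) <= m ^ t * (k ^ t.+1 * X c T).
    by rewrite mulnA; apply: leq_trans cFG; apply: leq_addl.
  by rewrite leq_pmul2l ?expn_gt0 ?m0.
(* Bounding [X c T] by [M] lets one factor [M] cancel; [(a * m) ^ d <= M ^ d] then removes the
   remaining power of [M]. *)
have le1 : M * (a * M ^ d * bad c T) <= M * (m ^ t * k ^ t.+1).
  rewrite [X in _ <= X]mulnC; apply: leq_trans (leq_mul (leqnn _) XM).
  apply: leq_trans cFG; apply: leq_trans (leq_addr _ _).
  by rewrite expnS; apply/eq_leq; ring.
rewrite leq_pmul2l // in le1.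
rewrite -(@leq_pmul2l (m ^ d)) ?expn_gt0 ?m0 //.
have -> : m ^ d * (k ^ t.+1 * m ^ d.+1) = m ^ t * k ^ t.+1.
  by rewrite /t !expnS mul2n -addnn !expnD; ring.
apply: leq_trans le1.
have : (a * m) ^ d <= M ^ d by case: (d) => [|u] //; rewrite leq_exp2r.
rewrite expnMn expnS => h.
have -> : m ^ d * (a * a ^ d * bad c T) = a * (a ^ d * m ^ d) * bad c T by ring.
by rewrite leq_mul2r leq_mul2l h !orbT.
Qed.


(** With [a = 2 * d * k ^ 2], the power [a ^ d] contains [k ^ (2 * d)], which cancels. The remaining
    bound [m ^ d] contradicts the strict lower bound that danger of the empty tuple would force. *)
Lemma nondanger_step (A : {set V}) (d m : nat) :
  0 < k -> 0 < d -> 0 < m -> 2 * d * k ^ 2 * m <= #|A| ->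
  exists c, exists2 B : {set V}, B \subset A
    & #|A| <= k ^ (2 * d) * #|B| + 2 * d * k ^ 2 * m
    /\ ~~ danger (colrel c) m (2 * d) A B d [::].
Proof.
move=> k0 d0 m0 aA.
have a0 : 0 < 2 * d * k ^ 2 by rewrite !muln_gt0 d0 k0.
have [c [B BA [leA bad]]] := dependent_random_choice k0 d0 m0 a0 aA.
exists c, B => //; split=> //; apply/negP => /(danger_sum_seq m0).
rewrite d0 addn1 ltnNge => /negP []; move: bad.
rewrite expnMn -expnM [_ * k ^ _]mulnC -mulnA leq_pmul2l //.
by rewrite expn_gt0 k0.
Qed.

Definition nondanger_chain (d m : nat) (c : 'I_k) (r : nat) (B : {set V}) :=
  exists2 A : nat -> {set V}, A 0 = B
    & forall i, i < r -> A i \subset A i.+1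
        /\ ~~ danger (colrel c) m (2 * d) (A i.+1) (A i) d [::].

(** Danger is monotone in the inner set, so a chain of one color survives the steps made in other
    colors. *)
Lemma nondanger_chainS d m c r (A B : {set V}) :
  B \subset A -> nondanger_chain d m c r A -> nondanger_chain d m c r B.
Proof.
move=> BA [S S0 HS]; exists (fun i => if i is 0 then B else S i) => // -[|i] ir.
  have [S01 nd] := HS 0 ir; rewrite S0 in S01 nd.
  by split; [apply: subset_trans S01 | apply: contra nd; apply: dangerS].
exact: HS.
Qed.

Lemma nondanger_chain_cons d m c r (A B : {set V}) :
  B \subset A -> ~~ danger (colrel c) m (2 * d) A B d [::] ->
  nondanger_chain d m c r A -> nondanger_chain d m c r.+1 B.
Proof.
move=> BA nd [S S0 HS].
exists (fun i => if i is i'.+1 then S i' else B) => // -[|i] ir.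
  by rewrite S0.
exact: HS.
Qed.

(* Adding [a * m] to the sizes turns the loss of the step
   [#|A| <= k ^ (2 * d) * #|B| + a * m] into a purely multiplicative one. *)
Lemma nondanger_chains d m s (A : {set V}) (r : 'I_k -> nat) :
  1 < k -> 0 < d -> 0 < m ->
  let a := 2 * d * k ^ 2 in
  k ^ (2 * d * s) * (2 * (a * m)) <= #|A| + a * m ->
  (forall c, nondanger_chain d m c (r c) A) ->
  exists B : {set V}, exists r' : 'I_k -> nat,
    [/\ a * m <= #|B|, \sum_c r' c = \sum_c r c + s
      & forall c, nondanger_chain d m c (r' c) B].
Proof.
move=> k1 d0 m0 a; have k0 : 0 < k by apply: ltn_trans k1.
elim: s A r => [|s IH] A r leA chA.
  exists A, r; rewrite addn0; split => //.
  by move: leA; rewrite muln0 mul1n mul2n -addnn leq_add2r.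
(* For [K = k ^ (2 * d) >= 2], the loss is absorbed: [K * #|B| + 2 * (a * m) <= K * (#|B| + a *
   m)]. *)
have kd : 1 < k ^ (2 * d).
  by apply: leq_trans (ltn_expl (2 * d) k1); rewrite ltnS muln_gt0.
have aA : a * m <= #|A|.
  rewrite -(leq_add2r (a * m)); apply: leq_trans leA.
  by rewrite addnn -mul2n leq_pmull // expn_gt0 k0.
have [c [B BA [leAB nd]]] := nondanger_step k0 d0 m0 aA.
have leB : k ^ (2 * d * s) * (2 * (a * m)) <= #|B| + a * m.
  rewrite -(@leq_pmul2l (k ^ (2 * d))); last exact: ltn_trans kd.
  rewrite mulnA -expnD -mulnS; apply: leq_trans leA _.
  rewrite mulnDr; move: leAB; rewrite -/a.
  move: (k ^ (2 * d)) (a * m) kd => K am; clear; nia.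
pose r1 c' := r c' + (c' == c).
have [|B' [r' [aB' sr' ch]]] := IH B r1 leB.
  move=> c'; rewrite /r1; case: eqP => [->|_].
    by rewrite addn1; apply: nondanger_chain_cons (chA c).
  by rewrite addn0; apply: nondanger_chainS (chA c').
exists B', r'; split=> //; rewrite sr' /r1 big_split /= -addnA; congr addn.
by rewrite (bigD1 c) //= eqxx big1 ?addn0 ?add1n // => i /negbTE ->.
Qed.

End DependentRandomChoice.

(** * Greedy embedding along a chain *)

(* The vertices of [G] are embedded one after the other, the list [us] being
   filled from its end; the vertex [x] goes to [A (phi x)], and the images of
   the neighbors of [w] in lower classes form a tuple of [A (phi w).-1] which
   is never dangerous. *)
Section Embedding.
Variables (G : sgraph) (V : finType) (R : rel V) (phi : G -> nat).
Variables (n d r : nat) (A : nat -> {set V}).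
Hypothesis R_sym : symmetric R.
Hypothesis phi_proper : forall x y, adj x y -> phi x != phi y.
Hypothesis phi_le : forall x, phi x <= r.
Hypothesis degree_le : forall x : G, degree x <= d.
Hypothesis card_le : #|G| <= n.
Hypotheses (n0 : 0 < n) (d0 : 0 < d).
Hypothesis A0 : 2 * n <= #|A 0|.
Hypothesis A_chain : forall i, i < r -> A i \subset A i.+1
  /\ ~~ danger R (2 * n) (2 * d) (A i.+1) (A i) d [::].

Let lower (w x : G) := adj w x && (phi x < phi w).

Lemma chain_subset i j : i <= j -> j <= r -> A i \subset A j.
Proof.
move=> ij; rewrite -(subnK ij); elim: (j - i) => [|t IH] //= tr.
apply: (subset_trans (IH (ltnW tr))).
by case: (A_chain tr).
Qed.

Lemma embed_seq (us : seq G) :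
  sorted (fun x y => phi y <= phi x) us -> uniq us ->
  exists f : G -> V,
  let S w := [seq f x | x <- us & lower w x] in
  [/\ {in us &, injective f}, {in us, forall x, f x \in A (phi x)},
     {in us &, forall x y, adj x y -> R (f x) (f y)}
   & forall w, 0 < phi w ->
     ~~ danger R (2 * n) (2 * d) (A (phi w)) (A (phi w).-1) (d - size (S w)) (S w)].
Proof.
elim: us => [|v us IH] /=.
  (* [v0] serves as the default value of [f]. *)
  have [v0|] := pickP (mem (A 0)); last first.
    move=> A00; move: A0; rewrite (eq_card0 A00) leqn0 muln_eq0.
    by case: n n0.
  move=> _ _ _; exists (fun=> v0); split=> // w.
  case: (phi w) (phi_le w) => [|i] //= ir _; rewrite subn0.
  by case: (A_chain ir).
rewrite (path_sortedE (leT := fun x y => phi y <= phi x)); last first.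
  by move=> x y z h1 h2; apply: leq_trans h2 h1.
case/andP=> /allP le_v sort_us /andP [v_us uniq_us].
have [f /= [injf fA fR fd]] := IH sort_us uniq_us.
pose S w := [seq f x | x <- us & lower w x].
rewrite -/S in fd.
have size_S w : size (S w) + (lower w v) <= d.
  apply: leq_trans (degree_le w).
  have -> : size (S w) + lower w v = size [seq x <- v :: us | lower w x].
    by rewrite /S size_map /=; case: lower; rewrite ?addn1 ?addn0.
  have /card_uniqP <- : uniq [seq x <- v :: us | lower w x].
    by rewrite filter_uniq //= v_us.
  apply: subset_leq_card; apply/subsetP => x; rewrite mem_filter inE.
  by case/andP => /andP [].
pose C := common R (A (phi v)) (S v).
have C_ge : 2 * n <= #|C|.
  rewrite /C; case: (posnP (phi v)) => [pv|pv].
    have -> : S v = [::].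
      rewrite /S (eq_filter (a2 := pred0)) ?filter_pred0 // => x.
      by rewrite /lower pv andbF.
    rewrite (_ : common _ _ _ = A 0) //.
    by apply/setP => y; rewrite !inE andbT pv.
  rewrite leqNgt; apply: contra (fd v pv) => /danger_common; apply.
  have : #|A 0| <= #|A (phi v).-1|.
    apply: subset_leq_card; apply: chain_subset => //.
    by apply: leq_trans (leq_pred _) (phi_le v).
  by move: A0 n0 d0; clear; nia.
(* The images of [v] that would make the tuple of [w] dangerous. Each of the at most [d] such [w]
   forbids at most [2 * n / (2 * d) = n / d] vertices. *)
pose D w := [set y in A (phi w).-1 | danger R (2 * n) (2 * d) (A (phi w))
               (A (phi w).-1) (d - size (S w)).-1 (y :: S w)].
have D_le w : lower w v -> d * #|D w| <= n.
  move=> wv; have := fd w; have := size_S w; rewrite wv addn1.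
  rewrite -subn_gt0 /D; case: (d - size _) => [|h] //= _ /(_ _).
  rewrite -leqNgt -mulnA leq_pmul2l //; apply.
  by case/andP: wv => _; apply: leq_ltn_trans.
pose U := [set w | lower w v].
have U_le : #|U| <= d.
  apply: leq_trans (degree_le v); apply: subset_leq_card; apply/subsetP => w.
  by rewrite !inE => /andP []; rewrite adj_sym.
pose bad := \bigcup_(w in U) D w.
have bad_le : #|bad| <= n.
  rewrite -(@leq_pmul2l d) //.
  apply: (@leq_trans (d * \sum_(w in U) #|D w|)).
    rewrite leq_mul2l; apply/orP; right; rewrite /bad.
    elim/big_rec2: _ => [|w b E _ IHE]; first by rewrite cards0.
    by apply: leq_trans (leq_card_setU _ _) _; rewrite leq_add2l.
  rewrite big_distrr /=; apply: (@leq_trans (\sum_(w in U) n)).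
    by apply: leq_sum => w; rewrite inE => /D_le.
  by rewrite sum_nat_const leq_mul2r U_le orbT.
pose used := [set f x | x in us].
have used_lt : #|used| < n.
  apply: leq_ltn_trans (leq_imset_card _ _) _.
  have /card_uniqP -> := uniq_us.
  have /card_uniqP /= <- : uniq (v :: us) by rewrite /= v_us.
  by apply: leq_trans card_le; apply: max_card.
(* At most [n] vertices are bad and fewer than [n] are used, [v] being still unplaced, against
   [2 * n] candidates. *)
have [y yC] : exists y, y \in C :\: (bad :|: used).
  apply/set0Pn; rewrite -card_gt0 cardsD subn_gt0.
  apply: leq_ltn_trans (subset_leq_card (subsetIr _ _)) _.
  apply: leq_ltn_trans (leq_card_setU _ _) _; move: C_ge bad_le used_lt.
  rewrite mul2n -addnn; clear; lia.
move: yC; rewrite !inE negb_or => /andP [/andP [y_bad y_used] /andP [yA yS]].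
pose f' x := if x == v then y else f x.
have f'v : f' v = y by rewrite /f' eqxx.
have f'us x : x \in us -> f' x = f x.
  by move=> xus; rewrite /f'; case: eqP xus v_us => // -> ->.
have f'S w : [seq f' x | x <- us & lower w x] = S w.
  by apply/eq_in_map => x; rewrite mem_filter => /andP [_ /f'us].
have y_us x : x \in us -> y <> f x.
  by move=> xus yx; move: y_used; rewrite yx /used imset_f.
have yR x : x \in us -> adj v x -> R y (f x).
  move=> xus vx; apply: (allP yS); apply: map_f; rewrite mem_filter xus andbT.
  rewrite /lower vx ltn_neqAle le_v // andbT eq_sym.
  exact: phi_proper.
exists f'; split.
- move=> x z; rewrite !inE => /orP [/eqP ->|xus] /orP [/eqP ->|zus] //.
  + by rewrite f'v f'us // => /y_us.
  + by rewrite f'v f'us // => /esym /y_us.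
  + by rewrite !f'us //; apply: injf.
- move=> x; rewrite inE => /orP [/eqP ->|xus]; first by rewrite f'v.
  by rewrite f'us //; apply: fA.
- move=> x z; rewrite !inE => /orP [/eqP ->|xus] /orP [/eqP ->|zus].
  + by rewrite adj_irrefl.
  + by rewrite f'v f'us //; apply: yR.
  + by rewrite f'v f'us // adj_sym R_sym; apply: yR.
  + by rewrite !f'us //; apply: fR.
move=> w pw; case: ifP => [wv|_]; last by rewrite f'S; apply: fd.
rewrite /= f'S f'v; apply: contra y_bad => dw.
apply/bigcupP; exists w; first by rewrite inE.
rewrite inE -subnS dw andbT.
apply: subsetP yA; apply: chain_subset; case/andP: wv => _ pvw.
  by rewrite -ltnS prednK.
by apply: leq_trans (leq_pred _) (phi_le w).
Qed.

Lemma embed_graph :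
  exists2 f : G -> V, injective f & forall x y, adj x y -> R (f x) (f y).
Proof.
pose le (x y : G) := phi y <= phi x.
have le_total : total le by move=> x y; apply: leq_total.
have [||f /= [injf _ fR _]] := @embed_seq (sort le (enum G)).
- exact: sort_sorted.
- by rewrite sort_uniq enum_uniq.
have inG x : x \in sort le (enum G) by rewrite mem_sort mem_enum.
by exists f => [x y|x y]; [apply: injf | apply: fR].
Qed.

End Embedding.

(** * The Ramsey bound *)

Lemma chromatic_numberP (G : sgraph) (q : nat) :
  chromatic_number G <= q ->
  exists2 phi : G -> nat, forall x, phi x < q
    & forall x y, adj x y -> phi x != phi y.
Proof.
rewrite /chromatic_number; case: ex_minnP => m /existsP [f /forallP fP] _ mq.
exists (fun x => nat_of_ord (f x)) => [x|x y xy].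
  by apply: leq_trans (ltn_ord _) mq.
exact: implyP (forallP (fP x) y) xy.
Qed.

Lemma mono_copy_edgeless (N k : nat) (c : edge_coloring N k) (i : 'I_k)
    (G : sgraph) :
  #|G| <= N -> (forall x y : G, ~~ adj x y) -> mono_copy c i G.
Proof.
move=> GN noadj; exists (fun x => widen_ord GN (enum_rank x)).
  by move=> x y /(congr1 val) /= /val_inj /enum_rank_inj.
by move=> x y; rewrite (negbTE (noadj x y)).
Qed.

(** The exponent left over after all the steps is [2 * d * (2 * k - 1)]; it pays for the additive
    losses and for [2 * n] in place of [n]. *)
Lemma leq_slack (k d : nat) :
  1 < k -> 0 < d -> 4 * (2 * d * k ^ 2) <= k ^ (2 * d * (2 * k).-1).
Proof.
move=> k1 d0; have d2 := ltn_expl d (ltnSn 1).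
apply: (@leq_trans (k ^ (4 * d + 2))); last first.
  by rewrite leq_exp2l //; move: k1 d0; clear; nia.
rewrite expnD mulnA leq_mul2r; apply/orP; right.
apply: (@leq_trans (2 ^ (4 * d))); last by rewrite leq_exp2r // muln_gt0.
have -> : 2 ^ (4 * d) = (2 ^ 3) ^ d * 2 ^ d.
  by rewrite -expnM -expnD; congr (2 ^ _); ring.
rewrite mulnA; apply: leq_mul (ltnW d2).
by have : (2 ^ 3) ^ 1 <= (2 ^ 3) ^ d by rewrite leq_exp2l.
Qed.

Lemma ramsey_prop_bound (k n q d : nat) (H : 'I_k -> sgraph) :
  1 < k -> 0 < n -> (forall i, #|H i| <= n) ->
  (forall i, chromatic_number (H i) <= q) ->
  (forall i, max_degree (H i) <= d) ->
  ramsey_prop H (k ^ (2 * k * d * q) * n).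
Proof.
move=> k1 n0 card_le chi_le deg_le c; have k0 : 0 < k by apply: ltn_trans k1.
set N := _ * n in c *.
have nN : n <= N by rewrite leq_pmull // expn_gt0 k0.
have degree_le i (x : H i) : degree x <= d.
  exact: leq_trans (leq_bigmax _) (deg_le i).
(* If [d = 0] or [q <= 1], there are no edges and any injection is a copy in any color. *)
case: (posnP d) => [d0|d0].
  exists (Ordinal k0); apply: mono_copy_edgeless.
    exact: leq_trans (card_le _) nN.
  move=> x y; apply/negP => xy; have := degree_le _ x.
  rewrite d0 leqn0 cards_eq0 => /eqP /setP /(_ y).
  by rewrite !inE xy.
case: (leqP q 1) => [q1|q1].
  exists (Ordinal k0); apply: mono_copy_edgeless.
    exact: leq_trans (card_le _) nN.
  have [phi phiq phiP] := chromatic_numberP (chi_le (Ordinal k0)).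
  move=> x y; apply/negP => /phiP.
  have z z' : phi z' = 0 by have := leq_trans (phiq z') q1; rewrite ltnS leqn0 => /eqP.
  by rewrite !z.
(* The junk colors [c [set x; x]] act as loops: the degrees of [x] in the
   [k] colors then add up to [N] exactly. *)
pose col (x y : 'I_N) := c [set x; y].
have col_sym x y : col x y = col y x by rewrite /col setUC.
pose s := (k * (q - 2)).+1.
pose a := 2 * d * k ^ 2.
have n20 : 0 < 2 * n by rewrite muln_gt0.
have leN : k ^ (2 * d * s) * (2 * (a * (2 * n))) <= #|[set: 'I_N]| + a * (2 * n).
  rewrite cardsT card_ord; apply: leq_trans (leq_addr _ _); rewrite /N.
  have -> : 2 * k * d * q = 2 * d * s + 2 * d * (2 * k).-1.
    have -> : q = (q - 2) + 2 by rewrite subnK.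
    rewrite /s -mulnDr; move: (q - 2) k0; clear; case: k => // k' u _.
    have -> : (2 * k'.+1).-1 = 2 * k' + 1 by lia.
    ring.
  rewrite expnD -[k ^ _ * _ * n]mulnA leq_mul2l; apply/orP; right.
  by have := leq_slack k1 d0; rewrite -/a; move: (k ^ _) n0; clear; nia.
have [|B [r [aB sr ch]]] :=
    @nondanger_chains _ k col col_sym d (2 * n) s [set: 'I_N] (fun=> 0) k1 d0 n20 leN.
  by move=> c'; exists (fun=> [set: 'I_N]).
have [i ri] : exists i, q.-1 <= r i.
  case: (boolP [exists i, q.-1 <= r i]) => [/existsP //|].
  rewrite negb_exists => /forallP rq; move: sr.
  rewrite [X in X + _]big1 // add0n => srs.
  suff : \sum_c r c <= k * (q - 2) by rewrite srs ltnn.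
  rewrite -[X in X * _]card_ord -sum_nat_const.
  apply: leq_sum => i _; move: (rq i); rewrite -ltnNge.
  by move: q1; clear; lia.
have [A A0 HA] := ch i; have [phi phiq phiP] := chromatic_numberP (chi_le i).
exists i.
(* [q.-1] steps give the [q] sets [A 0] to [A q.-1], matching the classes [0] to [q.-1] of [phi]. *)
have [||||f injf fR] := embed_graph (G := H i) (R := colrel col i) (phi := phi)
    (r := q.-1) (A := A) _ phiP _ (degree_le i) (card_le i) n0 d0.
- exact: colrel_sym.
- by move=> x; have := phiq x; move: q1; clear; lia.
- rewrite A0; apply: leq_trans aB; rewrite leq_pmull // /a.
  by rewrite !muln_gt0 d0 k0.
- by move=> j jq; apply: HA; apply: leq_trans ri.
by exists f => // x y xy; apply/eqP; apply: fR.
Qed.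

(** Descent to the least value; excluded middle decides whether a smaller one exists. *)
Lemma ex_ramsey_number (k : nat) (H : 'I_k -> sgraph) (N : nat) :
  0 < N -> ramsey_prop H N -> exists2 r, is_ramsey_number H r & r <= N.
Proof.
elim/ltn_ind: N => N IH N0 HN.
have [[M [M0 MN HM]]|noM] :=
    classic (exists M, [/\ 0 < M, M < N & ramsey_prop H M]).
  by have [r Hr rM] := IH M MN M0 HM; exists r => //; apply: leq_trans (ltnW MN).
exists N => //; split=> // M M0 HM; rewrite leqNgt; apply/negP => MN.
by apply: noM; exists M.
Qed.

Theorem theorem4p3 (k n q Delta : nat) (H : 'I_k -> sgraph)
    (hk : 2 <= k) (hn : 0 < n)
    (Hcard : forall i, #|H i| <= n)
    (Hchi : forall i, chromatic_number (H i) <= q)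
    (Hdeg : forall i, max_degree (H i) <= Delta) :
  exists2 r : nat, is_ramsey_number H r & r <= k ^ (2 * k * Delta * q) * n.
Proof.
apply: ex_ramsey_number; last exact: ramsey_prop_bound.
by rewrite muln_gt0 hn expn_gt0 (ltn_trans _ hk).
Qed.
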